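(* Let $\sigma_n$ denote the number of the card in the last position after one card-cyclic to random insertion shuffle of $n$ cards started from the identity, so that $\sigma\in S_n$ has law $p_n(\mathrm{id},\cdot)$. (i) If $b_nn\in\{1,\dots,n\}$ for each $n$ and $\lim_{n\to\infty}b_n=b\in[0,1)$, then $$\lim_{n\to\infty}n\,p_n(\mathrm{id},\{\sigma_n=b_nn\})=\frac{e^b}{e-1}.$$ In particular, defining the probability measure $\nu_n^{L}$ on $[0,1]$ by $\nu_n^{L}(A)=p_n(\mathrm{id},\{\sigma_n\in nA\})$ for $A\subset[0,1]$, the measures $\nu_n^L$ converge weakly as $n\to\infty$ to the measure $\frac{e^x}{e-1}\,dx$ on $[0,1]$. (ii) If $b_nn\in\{1,\dots,n\}$ for each $n$, $\lim_{n\to\infty}b_n=1$ and $\lim_{n\to\infty}(n-b_nn)=\infty$, then $$\lim_{n\to\infty}n\,p_n(\mathrm{id},\{\sigma_n=b_nn\})=\frac{e}{e-1}.$$ (iii) For every fixed $l\in\{0,1,2,\dots\}$, $$\lim_{n\to\infty}n\,p_n(\mathrm{id},\{\sigma_n=n-l\})=\frac{e-e^{-l}}{e-1}.$$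
   Context: A permutation $\sigma\in S_n$ is viewed as a deck of cards numbered $1,\dots,n$ laid out in a row, where $\sigma_j$ is the number of the card in the $j$-th position from the left. The card-cyclic to random insertion shuffle removes each of the $n$ cards exactly once and immediately reinserts it in a position chosen uniformly from the $n$ possible positions (independently of the other insertions); the removals and reinsertions are performed one card at a time in the original left-to-right order of the cards. Starting from the identity $\mathrm{id}$ (cards in increasing order from left to right), the cards are thus removed and reinserted in the order $1,2,\dots,n$, and after card $j$ is reinserted in ''position $k$'' it is the $k$-th card from the left. $p_n(\mathrm{id},\cdot)$ denotes the distribution on $S_n$ of the deck after one such shuffle started from $\mathrm{id}$. *)

(* Defs.v *)
From HB Require Import structures.
From mathcomp Require Import all_boot all_order all_algebra perm.
From mathcomp Require Import all_classical all_reals all_analysis measurable_realfun.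

Set Implicit Arguments.
Unset Strict Implicit.
Unset Printing Implicit Defensive.

Import Order.TTheory GRing.Theory Num.Theory.
Import numFieldNormedType.Exports.
Local Open Scope classical_set_scope.
Local Open Scope ring_scope.

(* Cards and positions are both 0-based: c : 'I_n is the card numbered c.+1,  *)
(* and i : 'I_n is the position i.+1 from the left.                           *)

Definition deck (n : nat) (s : 'S_n) : seq 'I_n := [seq s i | i <- enum 'I_n].

(* The value 0 is taken only when n = 0. *)
Definition last_card (n : nat) (s : 'S_n) : nat :=
  last 0%N [seq (nat_of_ord c).+1 | c <- deck s].

Definition reinsert (n : nat) (d : seq 'I_n) (c k : 'I_n) : seq 'I_n :=
  take k (rem c d) ++ c :: drop k (rem c d).

(* The cards are moved in the order in which d0 lists them, whatever their    *)
(* positions at the time; ks lists the successive reinsertion positions.      *)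
Definition shuffle (n : nat) (d0 ks : seq 'I_n) : seq 'I_n :=
  foldl (fun d ck => reinsert d ck.1 ck.2) d0 (zip d0 ks).

Lemma perm_reinsert (n : nat) (d : seq 'I_n) (c k : 'I_n) :
  c \in d -> perm_eq (reinsert d c k) d.
Proof.
move=> cd; rewrite /reinsert perm_catC /= perm_sym; apply: (perm_trans (perm_to_rem cd)).
by rewrite perm_cons perm_sym perm_catC cat_take_drop.
Qed.

Lemma perm_shuffle (n : nat) (d ks : seq 'I_n) : perm_eq (shuffle d ks) d.
Proof.
rewrite /shuffle.
have : all (fun ck => ck.1 \in d) (zip d ks).
  apply/allP => -[c k] /(map_f fst); rewrite -/(unzip1 _) /= => h.
  have: {subset unzip1 (zip d ks) <= d}.
    elim: (d) ks {h} => [|x d' IH] [|y ks] //= z; rewrite !inE.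
    by case/orP => [->//|/IH ->]; rewrite orbT.
  exact.
elim/last_ind: (zip d ks) => [//|s [c k] IH].
rewrite all_rcons => /andP[cd /IH ps]; rewrite foldl_rcons.
by rewrite (perm_trans (perm_reinsert _ _)) ?(perm_mem ps).
Qed.

Lemma deck_inj (n : nat) : injective (@deck n).
Proof.
move=> s t /eq_in_map st; apply/permP => i; apply: st.
by rewrite mem_enum.
Qed.

Lemma deck_surj (n : nat) (s : 'S_n) (d : seq 'I_n) :
  perm_eq d (deck s) -> exists t : 'S_n, deck t = d.
Proof.
move=> pd.
have sd : size d = n by rewrite (perm_size pd) size_map size_enum_ord.
have ud : uniq d.
  rewrite (perm_uniq pd) map_inj_uniq ?enum_uniq//; exact: perm_inj.
case: n => [|n] in s d pd sd ud *.
  by exists s; rewrite (size0nil sd); apply: size0nil;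
    rewrite size_map size_enum_ord.
have finj : injective (fun i : 'I_n.+1 => nth ord0 d i).
  move=> i j /eqP; rewrite nth_uniq ?sd// => /eqP; exact: val_inj.
exists (perm finj); apply: (@eq_from_nth _ ord0).
  by rewrite size_map size_enum_ord sd.
move=> i; rewrite size_map size_enum_ord => ilt.
rewrite (nth_map ord0) ?size_enum_ord// permE /=.
by rewrite nth_enum_ord.
Qed.

HB.instance Definition _ (T : finType) :=
  isPointed.Build (perm_type T) (1%g : {perm T}).

HB.instance Definition _ (T : finType) :=
  @isMeasurable.Build default_measure_display (perm_type T)
    discrete_measurable discrete_measurable0
    discrete_measurableC discrete_measurableU.

(* The n insertion positions are independent and uniform, i.e. the tuple ks   *)
(* is uniform among the n ^ n possible ones.                                  *)
Definition shuffle_pmf (R : realType) (n : nat) (s t : 'S_n) : R :=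
  #|[set ks : n.-tuple 'I_n | shuffle (deck s) ks == deck t]%SET|%:R /
  (n ^ n)%:R.

Definition shuffle_prob (R : realType) (n : nat) (s : 'S_n) :
    set 'S_n -> \bar R :=
  fun A => (\esum_(t in A) (shuffle_pmf R s t)%:E)%E.

Section shuffle_prob_measure.
Context (R : realType) (n : nat) (s : 'S_n).
Local Open Scope ereal_scope.

Lemma shuffle_pmf_ge0 t : (0 <= shuffle_pmf R s t)%R.
Proof. by rewrite divr_ge0. Qed.

Let shuffle_prob0 : shuffle_prob R s set0 = 0.
Proof. exact: esum_set0. Qed.

Let shuffle_prob_ge0 A : 0 <= shuffle_prob R s A.
Proof. by apply: esum_ge0 => t _; rewrite lee_fin shuffle_pmf_ge0. Qed.

Let shuffle_prob_sigma_additive : semi_sigma_additive (shuffle_prob R s).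
Proof.
move=> F mF tF mUF; rewrite /shuffle_prob; apply: cvg_toP.
  apply: ereal_nondecreasing_is_cvgn => a b ab.
  apply: lee_sum_nneg_natr => // k _ _; exact: shuffle_prob_ge0.
by rewrite nneseries_sum_bigcup// => i; rewrite lee_fin shuffle_pmf_ge0.
Qed.

HB.instance Definition _ := isMeasure.Build _ _ _ (shuffle_prob R s)
  shuffle_prob0 shuffle_prob_ge0 shuffle_prob_sigma_additive.

Lemma sum_shuffle_pmf : (\sum_(t : 'S_n) shuffle_pmf R s t = 1)%R.
Proof.
rewrite /shuffle_pmf -mulr_suml -natr_sum.
have -> : (\sum_(t : 'S_n)
    #|[set ks : n.-tuple 'I_n | shuffle (deck s) ks == deck t]%SET| =
    n ^ n)%N.
  transitivity #|[set: n.-tuple 'I_n]%SET|; last first.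
    by rewrite cardsT card_tuple card_ord.
  rewrite -sum1_card.
  transitivity (\sum_(t : 'S_n) \sum_(ks : n.-tuple 'I_n)
      if shuffle (deck s) ks == deck t then 1 else 0)%N.
    by apply: eq_bigr => t _; rewrite -big_mkcond sum1dep_card.
  rewrite exchange_big /= [RHS]big_mkcond /=.
  apply: eq_bigr => ks _; rewrite finset.in_setT.
  have [t tE] := deck_surj (perm_shuffle (deck s) ks).
  rewrite (bigD1 t)//= tE eqxx big1 ?addn0// => u ut.
  rewrite -?tE; case: eqP => // /deck_inj tu.
  by rewrite tu eqxx in ut.
rewrite divff// pnatr_eq0 -lt0n.
by case: n => // m; rewrite expn_gt0.
Qed.

Let shuffle_prob_setT : shuffle_prob R s [set: _] = 1.
Proof.
have -> : [set: 'S_n] = [set` enum 'S_n].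
  by apply/seteqP; split => // t _ /=; rewrite mem_enum.
rewrite /shuffle_prob esum_fset//; last first.
  by move=> t _; rewrite lee_fin shuffle_pmf_ge0.
by rewrite -fsbig_seq ?enum_uniq// big_enum /= sumEFin sum_shuffle_pmf.
Qed.

HB.instance Definition _ :=
  @Measure_isProbability.Build _ _ R (shuffle_prob R s) shuffle_prob_setT.

End shuffle_prob_measure.

Definition scaled_last (R : realType) (n : nat) (s : 'S_n) : R :=
  (last_card s)%:R / n%:R.

HB.instance Definition _ (R : realType) (n : nat) :=
  @isMeasurableFun.Build _ _ _ _ (@scaled_last R n)
    (fun _ _ _ => I).

Definition nuL (R : realType) (n : nat) :
    probability R R :=
  distribution (shuffle_prob R (1%g : 'S_n)) (@scaled_last R n).

(* For n = 0 the right-hand side would not be additive in A. *)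
Lemma nuLE (R : realType) (n : nat) (A : set R) : (0 < n)%N ->
  nuL R n A = shuffle_prob R (1%g : 'S_n)
    [set s | ([set n%:R * x | x in A] : set R) (last_card s)%:R].
Proof.
move=> n0; rewrite /nuL /= /distribution /pushforward; congr shuffle_prob.
have nN0 : n%:R != 0 :> R by rewrite pnatr_eq0 -lt0n.
apply/seteqP; split => s /=.
  move=> As; exists (scaled_last R s) => //.
  by rewrite /scaled_last mulrC divfK.
by move=> [x Ax xE]; rewrite /scaled_last -xE mulrC mulKf.
Qed.

Lemma nuL_itv01 (R : realType) (n : nat) : nuL R n `[0, 1]%classic = 1%E.
Proof.
rewrite -(probability_setT (shuffle_prob R (1%g : 'S_n))).
congr shuffle_prob; apply/seteqP; split => // s _ /=.
rewrite in_itv /= /scaled_last divr_ge0//=.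
have ln : (last_card s <= n)%N.
  have := mem_last 0%N [seq (nat_of_ord c).+1 | c <- deck s].
  rewrite -/(last_card s) inE => /predU1P[-> //|/mapP[c _ ->]].
  exact: ltn_ord.
have [n0|n0] := posnP n.
  by rewrite [X in _ / X%:R]n0 invr0 mulr0.
by rewrite ler_pdivrMr ?ltr0n// mul1r ler_nat.
Qed.

Definition limit_pdf (R : realType) : R -> R :=
  (fun x => expR x / (expR 1 - 1)) \_ `[0, 1].

Definition limit_prob (R : realType) : set R -> \bar R :=
  fun A => (\int[lebesgue_measure]_(x in A) (limit_pdf x)%:E)%E.

Section limit_prob_measure.
Context (R : realType).
Local Notation mu := (@lebesgue_measure R).

Let continuous_density :
  continuous (fun x : R => expR x / (expR 1 - 1)).
Proof.
move=> x; apply: (@continuousM _ R^o); first exact: continuous_expR.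
exact: cst_continuous.
Qed.

Let e1_gt0 : 0 < expR 1 - 1 :> R.
Proof. by rewrite subr_gt0 expR_gt1. Qed.

Lemma limit_pdf_ge0 (x : R) : 0 <= limit_pdf x.
Proof.
by apply: restrict_ge0 => {}x _; rewrite divr_ge0 ?expR_ge0// ltW.
Qed.

Lemma measurable_limit_pdf : measurable_fun [set: R] (@limit_pdf R).
Proof.
apply/measurable_restrict => //; apply: measurable_funTS.
exact: continuous_measurable_fun continuous_density.
Qed.

Let limit_prob0 : limit_prob (set0 : set R) = 0%E.
Proof. by rewrite /limit_prob integral_set0. Qed.

Let limit_prob_ge0 (A : set R) : (0 <= limit_prob A)%E.
Proof. by apply: integral_ge0 => x _; rewrite lee_fin limit_pdf_ge0. Qed.

Let limit_prob_sigma_additive : semi_sigma_additive (@limit_prob R).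
Proof.
move=> /= F mF tF mUF; rewrite /limit_prob; apply: cvg_toP.
  apply: ereal_nondecreasing_is_cvgn => m n mn.
  by apply: lee_sum_nneg_natr => // k _ _; exact: limit_prob_ge0.
rewrite ge0_integral_bigcup//=.
- apply/measurable_funTS/measurableT_comp => //.
  exact: measurable_limit_pdf.
- by move=> x _; rewrite lee_fin limit_pdf_ge0.
Qed.

HB.instance Definition _ := isMeasure.Build _ _ _ (@limit_prob R)
  limit_prob0 limit_prob_ge0 limit_prob_sigma_additive.

Let limit_prob_setT : limit_prob [set: R] = 1%E.
Proof.
rewrite /limit_prob -[X in integral _ _ X]/(EFin \o @limit_pdf R).
rewrite /limit_pdf -restrict_EFin -integral_mkcond.
rewrite (@continuous_FTC2 _ _ (fun x : R => expR x / (expR 1 - 1)))//.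
- by rewrite -EFinB expR0 -mulrBl divff// gt_eqF.
- exact: continuous_subspaceT.
- split.
  + by move=> z _; exact: ex_derive.
  + by apply/cvg_at_right_filter; exact: continuous_density.
  + by apply/cvg_at_left_filter; exact: continuous_density.
- move=> z _; rewrite derive1Mr// derive1E.
  by have /funeqP -> := @derive_expR R.
Qed.

HB.instance Definition _ :=
  @Measure_isProbability.Build _ _ R (@limit_prob R) limit_prob_setT.

End limit_prob_measure.

(* Weak convergence on the subspace D of the line: the test functions need    *)
(* only be defined, continuous and bounded on D.                              *)
Definition weak_cvg_on (R : realType) (D : set R)
    (mu : nat -> probability R R)
    (m : probability R R) : Prop :=
  forall f : R -> R, {within D, continuous f} -> [bounded f x | x in D] ->
    (\int[mu n]_(x in D) (f x)%:E)%E @[n --> \oo] -->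
    (\int[m]_(x in D) (f x)%:E)%E.

(* Main.v *)
Require Import Defs.
From mathcomp Require Import all_boot all_order all_algebra perm ring lra zify.
From mathcomp Require Import all_classical all_reals all_analysis measurable_realfun.

Set Implicit Arguments.
Unset Strict Implicit.
Unset Printing Implicit Defensive.

(* Suppose some card is reinserted in the last position.  The last one for    *)
(* which this happens ends up in the last position.  Otherwise card n stays   *)
(* last until its own turn, while cards 1, ..., n - 1 undergo a shuffle of    *)
(* n - 1 cards in front of it; card n is then put before the last of them.    *)
(* Hence the scaled probabilities u_n(m) = n p_n(id, {sigma_n = m}) satisfy   *)
(*   u_n(m) = (1 - 1/n)^(n - m) + (1 - 1/n)^(n - 1) u_(n - 1)(m)    (m < n)   *)
(* and u_n(n) = 1.  The function (e^(m/n) - e^(-(n - m))) / (e - 1) satisfies *)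
(* this recurrence up to an error O(1/n), and the recurrence contracts errors *)
(* by a factor 1/2, so that it approximates u_n(m) within O(1/n) uniformly in *)
(* m.  The limits follow; for the weak convergence, nu_n^L and the limit law  *)
(* give masses to ](m - 1)/n, m/n] whose differences sum to O(1/n).           *)

(** * Counting the reinsertion sequences by the last card *)

(** The exact input is [nb_last_rec]. As far as the last card is concerned, a move to the last
    position erases the memory of all earlier moves ([lastN_last]); without such a move the last
    card is that of a smaller shuffle ([lastN_restrict]). In the bulk, with x = m/n, the recurrence
    tends to f(x) = e^(x-1) + f(x)/e, solved by e^x/(e-1). Near card n, with l = n - m bounded, it
    tends to h(l) = 1 + h(l-1)/e with h(0) = 1, solved by (e - e^(-l))/(e-1). [profile] merges both
    regimes, and [nlast_profile] bounds its distance to the scaled probabilities uniformly in the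
    card. This gives the pointwise limits through [last_card_cvg] and the weak limit through
    [sum_dist_itv]. *)

(** With cards of any type and natural positions, decks of n and of n + 1 cards live in the same
    type [seq nat]. *)
Definition moves (T : eqType) (d : seq T) (s : seq (T * nat)) : seq T :=
  foldl (fun d ck => take ck.2 (rem ck.1 d) ++ ck.1 :: drop ck.2 (rem ck.1 d)) d s.

Lemma map_moves (T U : eqType) (f : T -> U) (d : seq T) (s : seq (T * nat)) :
  injective f ->
  map f (moves d s) = moves (map f d) [seq (f ck.1, ck.2) | ck <- s].
Proof.
move=> fI; have map_rem c e : map f (rem c e) = rem (f c) (map f e).
  by elim: e => //= x e IH; rewrite inj_eq//; case: eqP => //= _; rewrite IH.
rewrite /moves; elim: s d => //= -[c k] s IH d.
by rewrite IH/= map_cat/= map_take map_drop map_rem.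
Qed.

Lemma perm_moves (T : eqType) (d : seq T) (s : seq (T * nat)) :
  all (fun ck => ck.1 \in d) s -> perm_eq (moves d s) d.
Proof.
rewrite /moves; elim: s d => //= -[c k] s IH d /= /andP[cd sd].
have pd : perm_eq (take k (rem c d) ++ c :: drop k (rem c d)) d.
  rewrite perm_catC /= perm_sym; apply: (perm_trans (perm_to_rem cd)).
  by rewrite perm_cons perm_sym perm_catC cat_take_drop.
apply: (perm_trans _ pd); apply: IH; apply: sub_all sd => ck.
by rewrite (perm_mem pd).
Qed.

(** Without the moved card, [size d] cards remain, the final [x] included, so a position below
    [size d] always falls before [x]. Both cases of the recurrence rest on this. *)
Lemma moves_rcons (T : eqType) (d : seq T) (x : T) (s : seq (T * nat)) :
  all (fun ck => (ck.1 \in d) && (ck.2 < size d)) s ->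
  moves (rcons d x) s = rcons (moves d s) x.
Proof.
elim: s d => //= -[c k] s IH d /= /andP[/andP[cd kd] sd].
have rem_rcons : rem c (rcons d x) = rcons (rem c d) x.
  elim: d cd {kd sd IH} => //= y d IH; rewrite inE eq_sym.
  by case: eqP => //= _ /IH ->.
have kr : k <= size (rem c d) by rewrite size_rem// -ltnS prednK// (leq_ltn_trans _ kd).
have pd : perm_eq (moves d [:: (c, k)]) d by apply: perm_moves; rewrite /= cd.
rewrite rem_rcons -cats1 takel_cat// drop_cat.
have -> : (if k < size (rem c d) then drop k (rem c d) ++ [:: x]
    else drop (k - size (rem c d)) [:: x]) = drop k (rem c d) ++ [:: x].
  case: ltnP => // rk; have -> : k = size (rem c d) by apply/eqP; rewrite eqn_leq kr.
  by rewrite subnn drop_size.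
rewrite -cat_cons catA cats1 -/(moves _ _) IH//.
by apply: sub_all sd => ck; rewrite (perm_mem pd) (perm_size pd).
Qed.

(* Cards are 0-based here: last_card is the successor of lastN. *)
Definition lastN (n : nat) (ks : seq nat) : nat :=
  last 0 (moves (iota 0 n) (zip (iota 0 n) ks)).

Lemma all_zip1 (T U : Type) (a : pred T) (s : seq T) (t : seq U) :
  all a s -> all (fun p => a p.1) (zip s t).
Proof. by elim: s t => [|x s IH] [|y t] //= /andP[-> /IH ->]. Qed.

Lemma all_zip2 (T U : Type) (a : pred U) (s : seq T) (t : seq U) :
  all a t -> all (fun p => a p.2) (zip s t).
Proof. by elim: s t => [|x s IH] [|y t] //= /andP[-> /IH ->]. Qed.

Lemma lastN_last n ks i : size ks = n.+1 -> i <= n -> nth 0 ks i = n ->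
  (forall j, i < j <= n -> nth 0 ks j < n) -> lastN n.+1 ks = i.
Proof.
move=> sks ile ki kj.
have -> : ks = take i ks ++ n :: drop i.+1 ks.
  by rewrite -[LHS](cat_take_drop i) (drop_nth 0) ?sks// ki.
have iE : iota 0 n.+1 = iota 0 i ++ i :: iota i.+1 (n - i).
  by rewrite -[n.+1](@subnKC i) ?iotaD ?add0n ?subSn// ltnW.
rewrite /lastN {2}iE zip_cat ?size_take ?sks ?size_iota ?ltnS ?ile//.
rewrite /moves foldl_cat -/(moves _ _) /= -/(moves _ _).
set D := moves _ (zip (iota 0 i) _).
have pD : perm_eq D (iota 0 n.+1).
  apply/perm_moves/(@all_zip1 _ _ (mem (iota 0 n.+1))); apply/allP => j.
  rewrite /= -[0 :: _]/(iota 0 n.+1) !mem_iota !add0n /=.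
  by move=> ji; rewrite (leq_trans ji (leqW ile)).
have iD : i \in D by rewrite (perm_mem pD) mem_iota.
have sD : size (rem i D) = n by rewrite size_rem// (perm_size pD) size_iota.
(* Position n is the size of the remaining deck, so card [i] lands at its end, and the later moves
   take place in front of it. *)
rewrite take_oversize ?sD// drop_oversize ?sD// cats1 moves_rcons.
  by rewrite last_rcons.
rewrite sD; apply/allP => -[c k] ckz /=; apply/andP; split.
  have : c \in iota i.+1 (n - i).
    exact: (allP (all_zip1 (drop i.+1 ks) (allss (iota i.+1 (n - i)))) _ ckz).
  rewrite mem_rem_uniq ?(perm_uniq pD) ?iota_uniq// mem_iota !inE => /andP[ic].
  rewrite addSn subnKC// => cn; rewrite (perm_mem pD) mem_iota cn andbT.
  by rewrite gtn_eqF.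
suff kn : all (fun k => k < n) (drop i.+1 ks).
  exact: (allP (all_zip2 (iota i.+1 (n - i)) kn) _ ckz).
apply/(all_nthP 0) => j; rewrite size_drop sks subSS => jn.
rewrite nth_drop; apply: kj; rewrite ltnS leq_addr/=.
by rewrite addSn -ltn_subRL.
Qed.

(** Card n stays last while the others move. Its own move then puts it at k < n, in front of a
    nonempty suffix of the smaller deck, whose last card thus becomes last. *)
Lemma lastN_restrict n ks k : size ks = n -> all (fun k => k < n) (rcons ks k) ->
  lastN n.+1 (rcons ks k) = lastN n ks.
Proof.
move=> sks; rewrite all_rcons => /andP[kn ksn].
rewrite /lastN -[n.+1]addn1 iotaD add0n /= cats1.
rewrite zip_rcons ?size_iota// {1}/moves foldl_rcons -/(moves _ _) /=.
have zn : all (fun p => p.1 \in iota 0 n) (zip (iota 0 n) ks).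
  exact: all_zip1 (allss _).
rewrite moves_rcons; last first.
  have /= kz := all_zip2 (iota 0 n) ksn.
  by rewrite size_iota; apply/allP => p pz; rewrite (allP zn)//= (allP kz).
have pD := perm_moves zn.
set D := moves _ _ in pD *.
have nD : n \notin D by rewrite (perm_mem pD) mem_iota ltnn andbF.
have -> : rem n (rcons D n) = D.
  elim: D nD {pD} => /= [|x D IH]; first by rewrite eqxx.
  by rewrite inE negb_or eq_sym => /andP[/negbTE-> /IH->].
rewrite -[in RHS](cat_take_drop k D) !last_cat/=.
have : 0 < size (drop k D) by rewrite size_drop (perm_size pD) size_iota subn_gt0.
by case: (drop k D).
Qed.

Definition nb_last n i := #|[set ks : n.-tuple 'I_n | lastN n (map val ks) == i]|.

Lemma card_tuple_family (T : finType) n (F : 'I_n -> pred T) :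
  #|[set ks : n.-tuple T | [forall j, tnth ks j \in F j]]| = \prod_(j < n) #|F j|.
Proof.
transitivity #|family F|; last by rewrite card_family foldrE big_map big_enum.
rewrite -[RHS](@on_card_preimset _ _ (@finfun_of_tuple T n)); last first.
  exists (@tuple_of_finfun T n) => x _; rewrite ?finfun_of_tupleK ?tuple_of_finfunK//.
apply: eq_card => ks; rewrite !inE; apply/forallP/forallP => h j; have := h j;
  by rewrite /finfun_of_tuple ?ffunE.
Qed.

(** The condition says that position n is chosen for the last time by card i: earlier cards choose
    freely among n + 1 positions, card i has no choice, and each of the n - i later cards avoids
    position n. *)
Lemma nb_last_max n i : i <= n ->
  #|[set ks : n.+1.-tuple 'I_n.+1 |
     (lastN n.+1 (map val ks) == i) && ~~ all (fun k => k < n) (map val ks)]|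
  = n.+1 ^ i * n ^ (n - i).
Proof.
move=> ile.
pose F (j : 'I_n.+1) : pred 'I_n.+1 := fun k =>
  if j < i then true else if j == i :> nat then k == ord_max else k != ord_max.
have nthE (ks : n.+1.-tuple 'I_n.+1) (j : 'I_n.+1) :
    nth 0 (map val ks) j = tnth ks j.
  by rewrite (nth_map ord0) ?size_tuple// (tnth_nth ord0).
have lt_max (k : 'I_n.+1) : (k < n) = (k != ord_max).
  by rewrite -val_eqE/= ltn_neqAle -ltnS ltn_ord andbT.
have lastE (ks : n.+1.-tuple 'I_n.+1) (i' : 'I_n.+1) : tnth ks i' = ord_max ->
    (forall j : 'I_n.+1, i' < j -> tnth ks j != ord_max) ->
    lastN n.+1 (map val ks) = i'.
  move=> ki kj; apply: lastN_last => //; rewrite ?size_map ?size_tuple//.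
  - by rewrite -ltnS.
  - by rewrite nthE ki.
  move=> j /andP[ij jn]; rewrite -ltnS in jn.
  by rewrite (nthE _ (Ordinal jn)) lt_max kj.
transitivity #|[set ks : n.+1.-tuple 'I_n.+1 | [forall j, tnth ks j \in F j]]|.
  apply: eq_card => ks; rewrite !inE; apply/andP/forallP => [[/eqP li]|FP].
    rewrite all_map -has_predC => /(has_nthP ord0)[j0]; rewrite size_tuple => j0n.
    rewrite /= -ltnS => j0P.
    have {}j0P : tnth ks (Ordinal j0n) == ord_max.
      by rewrite (tnth_nth ord0) -[_ == _]negbK -lt_max.
    (* Let j be the last card sent to position n; by [lastE] it ends up last, hence j = i. *)
    have /= [j /eqP kj jmax] := @arg_maxnP _ _ (fun j => tnth ks j == ord_max) (fun j => j : nat) j0P.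
    have jlast (j' : 'I_n.+1) : j < j' -> tnth ks j' != ord_max.
      by move=> jj'; apply/negP => /jmax /= j'j; have := leq_trans jj' j'j; rewrite ltnn.
    have ji := lastE ks j kj jlast; rewrite li in ji.
    move=> j'; rewrite ?inE /F ji.
    case: ltngtP => // [/jlast//|/val_inj ->]; exact/eqP.
  have ki : tnth ks (Ordinal (ile : i < n.+1)) = ord_max.
    by have := FP (Ordinal (ile : i < n.+1)); rewrite ?inE /F/= ltnn eqxx => /eqP.
  split.
    rewrite (lastE _ _ ki)//= => j ij.
    by have := FP j; rewrite ?inE /F ltnNge (ltnW ij)/= gtn_eqF.
  rewrite all_map -has_predC; apply/(has_nthP ord0).
  by exists i; rewrite ?size_tuple//= -(tnth_nth _ _ (Ordinal (ile : i < n.+1))) ki ltnn.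
rewrite card_tuple_family.
pose g j := if j < i then n.+1 else if j == i then 1 else n.
rewrite (eq_bigr (fun j : 'I_n.+1 => g j)); last first.
  move=> j _; rewrite /F /g; case: ifP => _; first by rewrite cardT/= size_enum_ord.
  case: ifP => _; first exact: card1.
  by rewrite -[RHS]/(n.+1.-1) -[in RHS](card_ord n.+1) -(cardC1 (@ord_max n)).
rewrite -(big_mkord xpredT g) (big_cat_nat (n := i)) ?leqW//=.
rewrite [X in _ * X]big_ltn// /g ltnn eqxx mul1n; congr (_ * _).
  rewrite (eq_big_nat _ _ (F2 := fun=> n.+1)); last by move=> j /andP[_ ->].
  by rewrite prod_nat_const_nat subn0.
rewrite (eq_big_nat _ _ (F2 := fun=> n)); last first.
  by move=> j /andP[ij _]; rewrite ltnNge (ltnW ij) gtn_eqF.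
by rewrite prod_nat_const_nat subSS.
Qed.

(** Sequences avoiding position n correspond to pairs of a sequence for the first n cards and a free
    position of card n among n; the latter does not affect the last card and yields the factor n. *)
Lemma nb_last_rec n i : i <= n ->
  nb_last n.+1 i = n.+1 ^ i * n ^ (n - i) + n * nb_last n i.
Proof.
move=> ile; rewrite -nb_last_max// /nb_last.
rewrite -(cardsID [set ks : n.+1.-tuple 'I_n.+1 | all (fun k => k < n) (map val ks)]).
rewrite addnC; congr (_ + _).
  by apply: eq_card => ks; rewrite !inE andbC.
rewrite -[X in X * _](card_ord n) -cardsT -cardsX.
pose w := widen_ord (leqnSn n).
have wI : injective w by move=> x y /(congr1 val)/= /val_inj.
pose f (p : 'I_n * n.-tuple 'I_n) : n.+1.-tuple 'I_n.+1 := [tuple of rcons (map w p.2) (w p.1)].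
have fI : injective f.
  move=> [k ks] [k' ks'] /(congr1 val)/= /rcons_inj[/(inj_map wI) kss kk].
  by congr (_, _); apply: val_inj.
rewrite -(card_imset _ fI); apply: eq_card => ks; rewrite !inE.
have w_surj (s : seq 'I_n.+1) : all (fun k => k < n) (map val s) ->
    exists s', s = map w s'.
  elim: s => [|k s IH] /=; first by exists [::].
  move=> /andP[kn /IH[s' ->]]; exists (Ordinal kn :: s') => /=.
  by congr (_ :: _); exact: val_inj.
have map_w (s : seq 'I_n) : map val (map w s) = map val s.
  by rewrite -map_comp; exact: eq_map.
have lt_w (s : seq 'I_n) : all (fun k => k < n) (map val s).
  by apply/allP => _ /mapP[k _ ->] /=.
have lastNE k' (ks' : n.-tuple 'I_n) :
    lastN n.+1 (map val (f (k', ks'))) = lastN n (map val ks').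
  rewrite /= map_rcons map_w lastN_restrict ?size_map ?size_tuple//.
  by rewrite all_rcons lt_w andbT /=.
apply/andP/imsetP => [[li ksn]|[[k' ks']]].
  have [s sE] := w_surj _ ksn.
  have ss : size s = n.+1 by rewrite -(size_map w) -sE size_tuple.
  case/lastP: s => // s k in sE ss *; move: ss; rewrite size_rcons => -[ss].
  have ksE : ks = f (k, Tuple (introT eqP ss)) by apply: val_inj; rewrite /= sE map_rcons.
  exists (k, Tuple (introT eqP ss)) => //.
  by rewrite !inE /= -[lastN n _](lastNE k (Tuple (introT eqP ss))) -ksE.
rewrite !inE/= => /eqP li ->; rewrite lastNE li; split => //.
by rewrite /= -map_rcons map_w lt_w.
Qed.

Lemma lastN_lt n ks : 0 < n -> lastN n ks < n.
Proof.
move=> n0; rewrite /lastN; set D := moves _ _.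
have pD : perm_eq D (iota 0 n) by apply/perm_moves/all_zip1/allss.
have sD : 0 < size D by rewrite (perm_size pD) size_iota.
suff : last 0 D \in iota 0 n by rewrite mem_iota.
by rewrite -(perm_mem pD); case: D sD {pD} => //= x D _; exact: mem_last.
Qed.

Lemma nb_last_oversize n i : n <= i -> 0 < n -> nb_last n i = 0.
Proof.
move=> ni n0; apply/eqP; rewrite cards_eq0; apply/eqP/setP => ks; rewrite !inE.
by apply/negbTE; rewrite neq_ltn (leq_trans (lastN_lt _ n0)).
Qed.

Import Order.TTheory GRing.Theory Num.Theory.
Import numFieldNormedType.Exports.
Local Open Scope classical_set_scope.
Local Open Scope ring_scope.

(** * Uniform asymptotics *)

(* In the notation of the header, nlast R n i is u_(n + 1)(i + 1). *)
Definition nlast (R : realType) (n i : nat) : R := (nb_last n.+1 i)%:R / (n.+1 ^ n)%:R.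

Lemma nlast_rec (R : realType) n i : (i <= n)%N ->
  let x : R := n.+1%:R / n.+2%:R in
  nlast R n.+1 i = x ^+ (n.+1 - i) + x ^+ n.+1 * nlast R n i.
Proof.
move=> ile x; rewrite /nlast nb_last_rec ?leqW//.
rewrite natrD !natrM !natrX /x !expr_div_n.
have -> : n.+2%:R ^+ n.+1 = n.+2%:R ^+ i * n.+2%:R ^+ (n.+1 - i) :> R.
  by rewrite -exprD subnKC// leqW.
rewrite [in n.+1%:R ^+ n.+1]exprS; set a := n.+1%:R; set b := n.+2%:R; field.
by rewrite !expf_neq0// pnatr_eq0.
Qed.

Lemma nlast_max (R : realType) n : nlast R n n = 1.
Proof.
rewrite /nlast nb_last_rec// subnn expn0 muln1.
(* For n = 0 it is the factor n that vanishes: [nb_last 0 0] is 1, because of the default value of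
   [last]. *)
have -> : (n * nb_last n n = 0)%N.
  by case: n => // n; rewrite nb_last_oversize ?muln0.
by rewrite addn0 divff// pnatr_eq0 expn_eq0.
Qed.

Lemma expR_dist_le (R : realType) (a b : R) : a <= b ->
  expR b - expR a <= expR b * (b - a).
Proof.
move=> ab; have h := expR_ge1Dx (a - b).
have : expR b * (1 + (a - b)) <= expR b * expR (a - b) by rewrite ler_wpM2l// expR_ge0.
rewrite -expRD (_ : b + (a - b) = a); [lra|ring].
Qed.

(** This is e^(-y) <= 1/(1 + y), together with (1 + y)(1 - y + y^2) = 1 + y^3 >= 1. *)
Lemma expRN_le_quadratic (R : realType) (y : R) : 0 <= y ->
  expR (- y) <= 1 - y + y ^+ 2.
Proof.
move=> y0; have h := expR_ge1Dx y.
rewrite expRN; apply: (@le_trans _ _ (1 + y)^-1).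
  by rewrite lef_pV2 ?posrE ?expR_gt0//; lra.
rewrite -[leLHS]mul1r ler_pdivrMr; last lra.
have : 0 <= y ^+ 3 by rewrite exprn_ge0.
rewrite !exprS expr0; nra.
Qed.

Lemma expR_dist_N1 (R : realType) (y : R) : 0 <= y -> y <= 1 ->
  `|expR (- (1 - y)) - expR (- 1)| <= y.
Proof.
move=> y0 y1; rewrite ger0_norm; last by rewrite subr_ge0 ler_expR; lra.
apply: (le_trans (expR_dist_le _)); first lra.
have -> : - (1 - y) - - 1 = y by ring.
by rewrite ler_piMl// expR_le1; lra.
Qed.

Lemma expR1_ge2 (R : realType) : 2 <= expR 1 :> R.
Proof. by have := expR_ge1Dx (1 : R); rewrite -[1 + 1]/(2%:R). Qed.

(* The limit profile e^x / (e - 1) at x = (i + 1) / (n + 1), corrected by the *)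
(* boundary layer of width O(1) at i = n.                                     *)
Definition profile (R : realType) (n i : nat) : R :=
  (expR (i.+1%:R / n.+1%:R) - expR (- (n - i)%:R)) / (expR 1 - 1).

Lemma dist_expX (R : realType) (x y : R) k : 0 <= x <= 1 -> 0 <= y <= 1 ->
  `|x ^+ k - y ^+ k| <= k%:R * `|x - y|.
Proof.
move=> /andP[x0 x1] /andP[y0 y1]; elim: k => [|k IH].
  by rewrite !expr0 subrr normr0 mul0r.
have -> : x ^+ k.+1 - y ^+ k.+1 = x * (x ^+ k - y ^+ k) + (x - y) * y ^+ k.
  rewrite !exprS; ring.
apply: (le_trans (ler_normD _ _)); rewrite !normrM -natr1 mulrDl mul1r.
apply: lerD.
  by apply: le_trans IH; rewrite ger0_norm// ler_piMl.
by rewrite ler_piMr// ger0_norm ?exprn_ge0// exprn_ile1.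
Qed.

Lemma divr_succ (R : realType) n : n%:R / n.+1%:R = 1 - n.+1%:R^-1 :> R.
Proof.
have -> : n%:R = n.+1%:R - 1 :> R by rewrite -natr1 addrK.
by rewrite mulrBl divff ?mul1r// pnatr_eq0.
Qed.

(** With N = n + 2, the bases 1 - 1/N and e^(-1/N) differ by at most 1/N^2, and a k-th power with k
    <= N multiplies this by at most N. *)
Lemma dist_expX_expR (R : realType) (n k : nat) : (k <= n.+2)%N ->
  `|(n.+1%:R / n.+2%:R) ^+ k - expR (- (k%:R / n.+2%:R))| <= n.+2%:R^-1 :> R.
Proof.
move=> kn; set N : R := n.+2%:R.
have N0 : 0 < N by rewrite ltr0n.
have -> : expR (- (k%:R / N)) = expR (- N^-1) ^+ k.
  by rewrite -expRM_natl mulrN.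
have xE : n.+1%:R / N = 1 - N^-1 := divr_succ R n.+1.
have N1 : N^-1 <= 1 by rewrite invf_le1// ler1n.
have kN : k%:R <= N by rewrite ler_nat.
move: {xE}(n.+1%:R / N) xE => x xE; clearbody N.
have Ni0 : 0 < N^-1 by rewrite invr_gt0.
have h1 := expR_ge1Dx (- N^-1).
have h2 := expRN_le_quadratic (ltW Ni0).
rewrite xE; apply: le_trans (dist_expX _ _ _) _.
- by apply/andP; split; lra.
- by rewrite expR_ge0 expR_le1; lra.
rewrite distrC ger0_norm; last lra.
apply: (@le_trans _ _ (N * N^-1 ^+ 2)).
  apply: ler_pM => //; lra.
by rewrite expr2 mulrA divff ?mul1r// gt_eqF.
Qed.

(** Bernoulli's inequality, (1 + 1/(n+1))^(n+1) >= 2, gives the contraction factor of the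
    recurrence. *)
Lemma ratio_expn_le (R : realType) (n : nat) :
  (n.+1%:R / n.+2%:R) ^+ n.+1 <= 2^-1 :> R.
Proof.
have h (k : nat) (y : R) : 0 <= y -> 1 + k%:R * y <= (1 + y) ^+ k.
  move=> y0; elim: k => [|k IH]; first by rewrite expr0 mul0r addr0.
  rewrite exprS -natr1; have : (1 + y) * (1 + k%:R * y) <= (1 + y) * (1 + y) ^+ k.
    by rewrite ler_wpM2l//; lra.
  have : 0 <= k%:R * y * y by rewrite !mulr_ge0.
  nra.
have := h n.+1 n.+1%:R^-1 ltac:(by []); rewrite divff ?pnatr_eq0//.
have -> : 1 + n.+1%:R^-1 = (n.+1%:R / n.+2%:R)^-1 :> R.
  by rewrite invf_div -[n.+2%:R]natr1 mulrDl divff ?mul1r 1?addrC// pnatr_eq0.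
move=> h2; rewrite -[leLHS]invrK lef_pV2 ?posrE//.
by rewrite -exprVn.
Qed.

(** The boundary terms cancel exactly, since e^(-(n+1-i)) = e^(-1) e^(-(n-i)). What remains is (e^a
    - e^a') e^(-1)/(e-1), which is small because a' - a = a'/(n+2). *)
Lemma profile_rec (R : realType) n i : (i <= n)%N ->
  `|profile R n.+1 i - (expR (- ((n.+1 - i)%:R / n.+2%:R)) +
     expR (- 1) * profile R n i)| <= n.+2%:R^-1.
Proof.
move=> ile; rewrite /profile.
have e2 := expR1_ge2 R.
set a : R := i.+1%:R / n.+2%:R; set a' : R := i.+1%:R / n.+1%:R.
have -> : - ((n.+1 - i)%:R / n.+2%:R) = a - 1 :> R.
  rewrite /a natrB ?leqW// -!natr1; field.
  by rewrite !natr1 pnatr_eq0.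
rewrite subSn// -[(n - i).+1%:R]natr1 opprD !expRD.
have eN : expR (- 1) * expR 1 = 1 :> R by rewrite -expRD addNr expR0.
have e0 : 0 < expR (-1) :> R := expR_gt0 _.
have -> : (expR a - expR (- (n - i)%:R) * expR (- 1)) / (expR 1 - 1) -
    (expR a * expR (- 1) +
     expR (- 1) * ((expR a' - expR (- (n - i)%:R)) / (expR 1 - 1))) =
    - ((expR a' - expR a) * (expR (- 1) / (expR 1 - 1))).
  rewrite (expRN 1); field.
  by rewrite expR_eq0 gt_eqF//; lra.
have aa : a <= a' by rewrite /a /a' ler_wpM2l// lef_pV2 ?posrE ?ltr0n// ler_nat.
have a1 : a' <= 1 by rewrite ler_pdivrMr ?mul1r ?ler_nat.
have aE : a' - a <= n.+2%:R^-1.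
  have -> : a' - a = a' * n.+2%:R^-1.
    by rewrite /a' /a -!natr1; field; rewrite !natr1 !pnatr_eq0.
  by rewrite ler_piMl.
have ed := expR_dist_le aa.
have em : expR a <= expR a' by rewrite ler_expR.
have em' : expR a' <= expR 1 by rewrite ler_expR.
rewrite normrN normrM !ger0_norm; [|by rewrite divr_ge0//; lra|lra].
rewrite mulrA ler_pdivrMr; last lra.
have : (expR a' - expR a) * expR (- 1) <= a' - a.
  rewrite mulrC [leRHS](_ : _ = expR (- 1) * (expR 1 * (a' - a))); last first.
    by rewrite mulrA eN mul1r.
  rewrite ler_wpM2l ?expR_ge0//.
  by apply: (le_trans ed); rewrite ler_wpM2r// subr_ge0.
move=> h; apply: (le_trans h); apply: (le_trans aE).
by rewrite ler_peMr//; lra.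
Qed.

Lemma profile_bound (R : realType) n i : (i <= n)%N -> `|profile R n i| <= 2.
Proof.
move=> ile; rewrite /profile.
have e2 := expR1_ge2 R.
set a : R := i.+1%:R / n.+1%:R.
have a0 : 0 <= a by rewrite divr_ge0.
have a1 : a <= 1 by rewrite ler_pdivrMr ?mul1r ?ler_nat.
have : expR (- (n - i)%:R) <= 1 :> R by rewrite expR_le1 oppr_le0.
have : expR a <= expR 1 by rewrite ler_expR.
have : 1 <= expR a by rewrite -expR0 ler_expR.
have : 0 < expR (- (n - i)%:R) :> R := expR_gt0 _.
move=> h1 h2 h3 h4; rewrite ger0_norm; last by rewrite divr_ge0//; lra.
by rewrite ler_pdivrMr; lra.
Qed.

(* The errors are at most C / (n + 2), as C / 2 + 6 <= C (n + 2) / (n + 3).   *)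
Lemma nlast_profile (R : realType) n i : (i <= n)%N ->
  `|nlast R n i - profile R n i| <= 36 / n.+2%:R.
Proof.
have e2 := expR1_ge2 R.
have max m : profile R m m = 1.
  by rewrite /profile subnn divff// oppr0 expR0 divff// gt_eqF//; lra.
elim: n i => [|n IH] i.
  by rewrite leqn0 => /eqP ->; rewrite nlast_max max subrr normr0 divr_ge0.
rewrite leq_eqVlt => /predU1P[->|].
  by rewrite nlast_max max subrr normr0 divr_ge0.
rewrite ltnS => ile; have {}IH := IH i ile.
rewrite nlast_rec//=.
have pr := profile_rec R ile; have pb := profile_bound R ile.
have h1 := @dist_expX_expR R n (n.+1 - i) (leq_trans (leq_subr _ _) (leqnSn _)).
have h2 := @dist_expX_expR R n n.+1 (leqnSn _).
have c2 := ratio_expn_le R n.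
set x := n.+1%:R / n.+2%:R in c2 h1 h2 *.
have c0 : 0 <= x ^+ n.+1 by rewrite exprn_ge0// divr_ge0.
have h3 : `|expR (- (n.+1%:R / n.+2%:R)) - expR (- 1)| <= n.+2%:R^-1 :> R.
  rewrite divr_succ; by rewrite expR_dist_N1 ?invr_ge0// invf_le1// ler1n.
set c := x ^+ n.+1 in c2 c0 h2 *; set y := n.+2%:R^-1 in pr h1 h2 h3 *.
set u := nlast R n i in IH *; set t := profile R n i in IH pr pb *.
(* In units of y = 1/(n+2), the five terms are at most 18 (the contracted old error), 2 and 2
   (replacing c by e^(-1) in two stages, as the profile is at most 2), 1 (the source term) and 1
   ([profile_rec]). *)
have -> : x ^+ (n.+1 - i) + c * u - profile R n.+1 i =
  c * (u - t) + (c - expR (- (n.+1%:R / n.+2%:R))) * t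
  + (expR (- (n.+1%:R / n.+2%:R)) - expR (- 1)) * t
  + (x ^+ (n.+1 - i) - expR (- ((n.+1 - i)%:R / n.+2%:R)))
  - (profile R n.+1 i - (expR (- ((n.+1 - i)%:R / n.+2%:R)) + expR (- 1) * t)).
  ring.
have b1 : `|c * (u - t)| <= 18 * y.
  rewrite normrM ger0_norm//; apply: (@le_trans _ _ (2^-1 * (36 / n.+2%:R))).
    by rewrite ler_pM.
  by rewrite -/y; lra.
have b2 (z : R) : `|z| <= y -> `|z * t| <= 2 * y.
  by move=> zy; rewrite normrM mulrC; apply: ler_pM.
apply: (@le_trans _ _ (24 * y)).
  apply: (le_trans (ler_normB _ _)).
  apply: (@le_trans _ _ (23 * y + y)); last lra.
  apply: lerD => //; apply: (le_trans (ler_normD _ _)).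
  apply: (@le_trans _ _ (22 * y + y)); last lra.
  apply: lerD => //; apply: (le_trans (ler_normD _ _)).
  apply: (@le_trans _ _ (20 * y + 2 * y)); last lra.
  apply: lerD; last exact: b2.
  apply: (le_trans (ler_normD _ _)).
  apply: (@le_trans _ _ (18 * y + 2 * y)); last lra.
  by apply: lerD => //; exact: b2.
(* The bound 24/(n+2) <= 36/(n+3) is an equality at n = 0, which dictates the constant 36. *)
rewrite /y ler_pdivrMr// mulrAC ler_pdivlMr// -!natrM ler_nat; lia.
Qed.

(** * The law of the last card *)

Lemma last_card_shuffle n (t : 'S_n.+1) (ks : n.+1.-tuple 'I_n.+1) :
  shuffle (deck 1%g) ks = deck t -> last_card t = (lastN n.+1 (map val ks)).+1.
Proof.
have deck1 : deck (1%g : 'S_n.+1) = enum 'I_n.+1.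
  by rewrite /deck -[RHS]map_id; apply: eq_map => i; rewrite perm1.
have foldE (d0 d ks' : seq 'I_n.+1) :
    foldl (fun d ck => reinsert d ck.1 ck.2) d (zip d0 ks') =
    moves d (zip d0 (map val ks')).
  by rewrite /moves; elim: d0 ks' d => [|c d0 IH] [|k ks'] d //=.
move=> dt; rewrite /last_card -dt /shuffle foldE deck1.
rewrite (map_comp succn val) (map_moves _ _ val_inj) val_enum_ord.
have map_zip (s1 : seq 'I_n.+1) (s2 : seq nat) :
    [seq (\val ck.1, ck.2) | ck <- zip s1 s2] = zip (map val s1) s2.
  by elim: s1 s2 => [|c s1 IH] [|k s2] //=; rewrite IH.
rewrite map_zip val_enum_ord.
rewrite /lastN; set D := moves _ _.
have : (0 < size D)%N.
  by rewrite (perm_size (perm_moves (all_zip1 _ (allss _)))) size_iota.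
by case: D => //= x D _; rewrite last_map.
Qed.

(** Each sequence of positions produces the deck of exactly one permutation, so exchanging the sums
    counts every sequence once. *)
Lemma sum_shuffle_last n i :
  (\sum_(t : 'S_n.+1 | last_card t == i.+1)
    #|[set ks : n.+1.-tuple 'I_n.+1 | shuffle (deck 1%g) ks == deck t]%SET| =
   nb_last n.+1 i)%N.
Proof.
rewrite /nb_last -sum1_card.
transitivity (\sum_(t : 'S_n.+1 | last_card t == i.+1)
    \sum_(ks : n.+1.-tuple 'I_n.+1)
      if shuffle (deck 1%g) ks == deck t then 1 else 0)%N.
  by apply: eq_bigr => t _; rewrite -big_mkcond sum1dep_card.
rewrite exchange_big /= [RHS]big_mkcond /=.
apply: eq_bigr => ks _; rewrite inE.
have [t tE] := deck_surj (perm_shuffle (deck 1%g) ks).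
rewrite big_mkcond (bigD1 t)//= tE eqxx big1 ?addn0; last first.
  move=> u ut; case: ifP => // _; rewrite -tE; case: eqP => // /deck_inj tu.
  by rewrite tu eqxx in ut.
by rewrite (last_card_shuffle (esym tE)) eqSS.
Qed.

Lemma shuffle_prob_last (R : realType) n i :
  shuffle_prob R (1%g : 'S_n.+1) [set s | last_card s = i.+1] =
  (nlast R n i / n.+1%:R)%:E.
Proof.
rewrite /shuffle_prob.
have -> : [set s : 'S_n.+1 | last_card s = i.+1] =
    [set` [seq s <- enum 'S_n.+1 | last_card s == i.+1]].
  apply/seteqP; split => s /=; rewrite mem_filter mem_enum andbT.
    by move=> ->.
  by move=> /eqP.
rewrite esum_fset//; last by move=> t _; rewrite lee_fin shuffle_pmf_ge0.
rewrite -fsbig_seq; last exact/filter_uniq/enum_uniq.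
rewrite big_filter big_enum_cond/=.
rewrite sumEFin /shuffle_pmf -mulr_suml -natr_sum sum_shuffle_last.
rewrite /nlast expnS [in LHS]natrM invfM; congr EFin; rewrite -mulrA; congr (_ * _).
by rewrite mulrC.
Qed.

Lemma nuL_itv (R : realType) n i :
  nuL R n.+1 `]i%:R / n.+1%:R, i.+1%:R / n.+1%:R]%classic =
  (nlast R n i / n.+1%:R)%:E.
Proof.
rewrite -shuffle_prob_last /nuL /= /distribution /pushforward; congr shuffle_prob.
apply/seteqP; split => s /=; rewrite in_itv /= /scaled_last.
  by rewrite ltr_pM2r ?invr_gt0// ler_pM2r ?invr_gt0// ltr_nat ler_nat => ?; lia.
by move=> ->; rewrite lexx ltr_pM2r ?invr_gt0// ltr_nat ltnSn.
Qed.

(** The half-open cells of the subdivision miss the endpoint 0, which carries no mass because cards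
    are numbered from 1. *)
Lemma nuL_set1 (R : realType) n : nuL R n.+1 [set 0] = 0%E.
Proof.
rewrite /nuL /= /distribution /pushforward -[RHS](measure0 (shuffle_prob R (1%g : 'S_n.+1))).
congr shuffle_prob; apply/seteqP; split => s //=; rewrite /scaled_last => /eqP.
rewrite mulf_eq0 invr_eq0 !pnatr_eq0 orbF /last_card.
have : (0 < size (deck s))%N by rewrite size_map size_enum_ord.
by case: (deck s) => //= c d _; rewrite last_map.
Qed.

Lemma limit_prob_itv (R : realType) (a b : R) : 0 <= a -> a < b -> b <= 1 ->
  limit_prob `]a, b]%classic = ((expR b - expR a) / (expR 1 - 1))%:E.
Proof.
move=> a0 ab b1; rewrite /limit_prob.
have cf : continuous (fun x : R => expR x / (expR 1 - 1)).
  move=> x; apply: (@continuousM _ R^o); first exact: continuous_expR.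
  exact: cst_continuous.
transitivity (\int[@lebesgue_measure R]_(x in `]a, b])
    (expR x / (expR 1 - 1))%:E)%E.
  apply: eq_integral => x; rewrite inE/= in_itv/= => /andP[ax xb]; rewrite /limit_pdf patchE mem_set//=.
  by rewrite in_itv/= (le_trans a0 (ltW ax)) (le_trans xb b1).
have mf := continuous_measurable_fun cf.
rewrite integral_itv_obnd_cbnd; last first.
  by apply/measurable_EFinP; exact: measurable_funTS mf.
rewrite (@continuous_FTC2 _ _ (fun x : R => expR x / (expR 1 - 1)))//.
- by rewrite -EFinB mulrBl.
- exact: continuous_subspaceT.
- split.
  + by move=> z _; exact: ex_derive.
  + by apply/cvg_at_right_filter; exact: cf.
  + by apply/cvg_at_left_filter; exact: cf.
- move=> z _; rewrite derive1Mr// derive1E.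
  by have /funeqP -> := @derive_expR R.
Qed.

Lemma limit_prob_set1 (R : realType) (a : R) : limit_prob [set a] = 0%E.
Proof. by rewrite /limit_prob integral_set1. Qed.

(** * Weak convergence by Riemann sums *)

Lemma itv_uniform_continuity (R : realType) (a b : R) (f : R -> R) (e : R) :
  {within `[a, b], continuous f} -> 0 < e ->
  \forall n \near \oo, forall x y, x \in `[a, b] -> y \in `[a, b] ->
    `|x - y| <= n.+1%:R^-1 -> `|f x - f y| <= e.
Proof.
move=> cf e0.
pose P (n : nat) (x : R) := forall y, y \in `[a, b] ->
  `|x - y| <= n.+1%:R^-1 -> `|f x - f y| <= e.
suff : \forall n \near \oo, `[a, b] `<=` P n.
  by apply: filterS => n h x y /h; exact.
apply: (iffRL (near_covering_withinP _)).
  exact/compact_near_coveringP/segment_compact.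
move=> x xab.
have := (iffLR (subspace_continuousP _ _) cf) x xab.
move=> /cvgrPdist_lt /(_ _ (divr_gt0 e0 (ltr0n _ 2))).
rewrite /= near_withinE => -[r /= r0 rP].
have r20 : 0 < r / 2 by rewrite divr_gt0.
exists (ball x (r / 2), [set n | n.+1%:R^-1 < r / 2]) => /=.
  split; first exact: nbhsx_ballx.
  exact: (near_infty_natSinv_lt (PosNum r20)).
move=> [z n] /= [xz nr] zab y yab zy.
have xr : `|x - z| < r by apply: (lt_trans xz); lra.
have yr : `|x - y| < r.
  rewrite -(subrK z x) -addrA (le_lt_trans (ler_normD _ _))//.
  rewrite [ltRHS](splitr r) ltrD//.
  exact: le_lt_trans zy nr.
have := rP z xr zab; have := rP y yr yab => h1 h2.
rewrite -(subrK (f x) (f z)) -addrA (le_trans (ler_normD _ _))//.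
by rewrite [leRHS](splitr e) lerD// ?(ltW h1)// distrC ltW.
Qed.

Lemma Rintegral_dist_cst (R : realType) (mu : probability R R) (I : set R) (f : R -> R) (c e : R) :
  measurable I -> mu.-integrable I (EFin \o f) ->
  (forall x, I x -> `|f x - c| <= e) ->
  `|\int[mu]_(x in I) f x - c * fine (mu I)| <= e * fine (mu I).
Proof.
move=> mI intf fc; have muI : (mu I < +oo)%E by rewrite -ge0_fin_numE// fin_num_measure.
have intc (r : R) : mu.-integrable I (EFin \o cst r).
  apply: measurable_bounded_integrable => //; exact: bounded_cst.
have intd : mu.-integrable I (EFin \o (fun x => f x - c)).
  exact: (integrableB mI intf (intc c)).
rewrite -!Rintegral_cst// -RintegralB//; last exact: intc.
apply: (le_trans (le_normr_Rintegral _ _)) => //.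
apply: le_Rintegral => //; [exact: integrable_norm intd|exact: intc].
Qed.

Lemma bounded_continuous_integrable (R : realType) (mu : probability R R)
    (D : set R) (f : R -> R) :
  measurable D -> {within D, continuous f} -> [bounded f x | x in D] ->
  mu.-integrable D (EFin \o f).
Proof.
move=> mD cf bf; apply: measurable_bounded_integrable => //.
  by rewrite -ge0_fin_numE// fin_num_measure.
exact: subspace_continuous_measurable_fun.
Qed.

(** On each cell f is within e of its value at the right endpoint, and the cells have total mass at
    most 1. The same estimate serves both [nuL] and [limit_prob]. *)
Lemma riemann_sum_approx (R : realType) (mu : probability R R) (f : R -> R) (n : nat) (e : R) :
  {within `[0, 1], continuous f} -> [bounded f x | x in `[0, 1]] ->
  (forall x y, x \in `[0, 1] -> y \in `[0, 1] ->
    `|x - y| <= n.+1%:R^-1 -> `|f x - f y| <= e) ->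
  mu [set 0] = 0%E ->
  `|\int[mu]_(x in `[0, 1]) f x - \sum_(i < n.+1) f (i.+1%:R / n.+1%:R) *
      fine (mu `]i%:R / n.+1%:R, i.+1%:R / n.+1%:R]%classic)| <= e.
Proof.
move=> cf bf fe mu0; set N : R := n.+1%:R.
have N0 : 0 < N by rewrite ltr0n.
have e0 : 0 <= e.
  have := fe 0 0; rewrite subrr normr0 subrr normr0 in_itv/= lexx ler01.
  by apply => //; rewrite invr_ge0.
have intf := bounded_continuous_integrable mu (measurable_itv _) cf bf.
have step k : (k <= n.+1)%N ->
    `|\int[mu]_(x in `]0, k%:R / N]) f x - \sum_(i < k) f (i.+1%:R / N) *
      fine (mu `]i%:R / N, i.+1%:R / N]%classic)|
    <= e * fine (mu `]0, k%:R / N]%classic).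
  elim: k => [_|k IH kn].
    by rewrite mul0r set_itv_ge ?bnd_simp// Rintegral_set0 big_ord0 subrr normr0 measure0 mulr0.
  have UE : `]0, k.+1%:R / N]%classic =
      `]0, k%:R / N]%classic `|` `]k%:R / N, k.+1%:R / N]%classic.
    rewrite -itv_bndbnd_setU ?bnd_simp//; last by rewrite ler_pM2r ?invr_gt0// ler_nat.
    exact: divr_ge0.
  have k1 : k.+1%:R / N <= 1 by rewrite ler_pdivrMr// mul1r ler_nat.
  have U1 : `]0, k.+1%:R / N]%classic `<=` `[0, 1]%classic.
    move=> x /=; rewrite !in_itv/= => /andP[/ltW -> xk]; exact: (le_trans xk).
  have disj : [disjoint `]0, k%:R / N]%classic & `]k%:R / N, k.+1%:R / N]%classic].
    apply/disj_setPS => x [] /=; rewrite !in_itv/= => /andP[_ xk] /andP[kx _].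
    by have := le_lt_trans xk kx; rewrite ltxx.
  have dI : `]0, k%:R / N]%classic `&` `]k%:R / N, k.+1%:R / N]%classic = set0.
    exact/disj_set2P.
  rewrite UE Rintegral_setU//; last first.
    by rewrite -UE; apply: integrableS intf.
  rewrite measureU//= big_ord_recr/= fineD ?fin_num_measure// mulrDr opprD addrACA.
  rewrite (le_trans (ler_normD _ _))// lerD//; first exact/IH/ltnW.
  apply: Rintegral_dist_cst => //.
    apply: integrableS intf => //; apply: subset_trans U1.
    by rewrite UE; exact: subsetUr.
  move=> x /=; rewrite in_itv/= => /andP[kx xk].
  apply: fe.
  - have k0 : 0 <= k%:R / N by rewrite divr_ge0.
    by rewrite in_itv/= (le_trans k0 (ltW kx)) (le_trans xk k1).
  - by rewrite in_itv/= k1 andbT divr_ge0.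
  rewrite distrC ger0_norm ?subr_ge0// lerBlDr.
  by rewrite -[k.+1%:R]natr1 mulrDl mul1r addrC lerD2l ltW.
have -> : \int[mu]_(x in `[0, 1]) f x = \int[mu]_(x in `]0, 1]) f x.
  have UE : `[0, 1]%classic = [set 0] `|` `]0, 1]%classic :> set R.
    by rewrite setU1itv ?bnd_simp.
  rewrite UE Rintegral_setU//.
  - rewrite {1}/Rintegral null_set_integral ?add0r//.
    exact: measurable_fun_set1.
  - by rewrite -UE.
  - by apply/disj_setPS => x [] /= ->; rewrite in_itv/= ltxx.
have := step n.+1 (leqnn _); rewrite divff ?gt_eqF// => h; apply: (le_trans h).
rewrite ler_piMr// -lee_fin fineK ?fin_num_measure//; exact: probability_le1.
Qed.

(** The boundary layer has bounded total weight S: the induction is S(n+1) = 1 + S(n)/e <= 1 +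
    2/2. *)
Lemma sum_expRN_le2 (R : realType) n :
  \sum_(i < n.+1) expR (- (n - i)%:R) <= 2 :> R.
Proof.
have e2 := expR1_ge2 R.
elim: n => [|n IH]; first by rewrite big_ord1 subnn oppr0 expR0; lra.
rewrite big_ord_recr/= subnn oppr0 expR0.
rewrite (eq_bigr (fun i : 'I_n.+1 => expR (- 1) * expR (- (n - i)%:R))); last first.
  by move=> i _; rewrite subSn -1?ltnS// -natr1 opprD expRD mulrC.
rewrite -mulr_sumr.
have : expR (-1) <= 2^-1 :> R by rewrite expRN lef_pV2 ?posrE ?expR_gt0.
have : 0 <= expR (- 1) :> R by rewrite expR_ge0.
nra.
Qed.

(** Here 38 is 36 from [nlast_profile] plus 2 from the second-order term of the limit mass of a
    cell; the exponential is the boundary layer of [profile]. *)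
Lemma dist_last_itv (R : realType) (n i : nat) : (i <= n)%N ->
  `|nlast R n i / n.+1%:R - (expR (i.+1%:R / n.+1%:R) - expR (i%:R / n.+1%:R)) / (expR 1 - 1)|
  <= (38 / n.+1%:R + expR (- (n - i)%:R)) / n.+1%:R.
Proof.
move=> ile; have e2 := expR1_ge2 R.
have np := nlast_profile R ile.
have np' : 36 / n.+2%:R <= 36 / n.+1%:R :> R by rewrite ler_pM2l// lef_pV2 ?posrE// ler_nat.
have {np'}np := le_trans np np'.
have e1 : expR (i.+1%:R / n.+1%:R) <= expR 1 :> R.
  by rewrite ler_expR ler_pdivrMr// mul1r ler_nat.
have y0 : 0 < n.+1%:R^-1 :> R by rewrite invr_gt0.
have y1 : n.+1%:R^-1 <= 1 :> R by rewrite invf_le1// ler1n.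
have -> : expR (i%:R / n.+1%:R) = expR (i.+1%:R / n.+1%:R) * expR (- n.+1%:R^-1) :> R.
  by rewrite -expRD -[i.+1%:R]natr1 mulrDl mul1r addrK.
have := expR_gt0 (- (n - i)%:R : R); have := expR_gt0 (i.+1%:R / n.+1%:R : R).
move: np; rewrite /profile.
move: (nlast R n i) (expR (- (n - i)%:R)) (expR (i.+1%:R / n.+1%:R)) e1 => u w a a1.
move: (n.+1%:R^-1) y0 y1 => y y0 y1 np a0 w0.
have q1 : 1 - y <= expR (- y) by exact: expR_ge1Dx.
have q2 : expR (- y) <= 1 - y + y * y by rewrite -expr2 expRN_le_quadratic ?ltW.
have -> : u * y - (a - a * expR (- y)) / (expR 1 - 1) =
  (u - (a - w) / (expR 1 - 1)) * y - w * y / (expR 1 - 1)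
  + a * (expR (- y) - (1 - y)) / (expR 1 - 1).
  by field; rewrite gt_eqF//; lra.
apply: (le_trans (ler_normD _ _)).
have b1 : `|a * (expR (- y) - (1 - y)) / (expR 1 - 1)| <= 2 * y * y.
  rewrite ger0_norm; last by rewrite divr_ge0 ?mulr_ge0//; lra.
  rewrite ler_pdivrMr; last lra.
  have : a * (expR (- y) - (1 - y)) <= expR 1 * (y * y) by apply: ler_pM => //; lra.
  have : 0 < y * y by rewrite mulr_gt0.
  nra.
have b2 : `|(u - (a - w) / (expR 1 - 1)) * y - w * y / (expR 1 - 1)| <=
    36 * y * y + w * y.
  apply: (le_trans (ler_normB _ _)); apply: lerD.
    by rewrite normrM (ger0_norm (ltW y0)) ler_wpM2r// ltW.
  rewrite ger0_norm; last by rewrite divr_ge0 ?mulr_ge0//; lra.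
  have : 0 < w * y by rewrite mulr_gt0.
  by move=> wy; rewrite ler_pdivrMr; [nra|lra].
nra.
Qed.

Lemma sum_dist_itv (R : realType) (n : nat) :
  \sum_(i < n.+1) `|fine (nuL R n.+1 `]i%:R / n.+1%:R, i.+1%:R / n.+1%:R]%classic)
    - fine (limit_prob (`]i%:R / n.+1%:R, i.+1%:R / n.+1%:R]%classic : set R))|
  <= 40 / n.+1%:R :> R.
Proof.
apply: (@le_trans _ _ (\sum_(i < n.+1)
    (38 / n.+1%:R + expR (- (n - i)%:R)) / n.+1%:R)).
  apply: ler_sum => i _; rewrite nuL_itv limit_prob_itv/=.
  - by apply: dist_last_itv; rewrite -ltnS.
  - exact: divr_ge0.
  - by rewrite ltr_pM2r ?invr_gt0// ltr_nat.
  - by rewrite ler_pdivrMr// mul1r ler_nat.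
rewrite -mulr_suml ler_pM2r ?invr_gt0// big_split/= sumr_const card_ord.
have -> : (38 / n.+1%:R *+ n.+1) = 38 :> R by rewrite -mulr_natr divfK// pnatr_eq0.
have := sum_expRN_le2 R n; lra.
Qed.

Lemma weak_cvg_nuL (R : realType) : weak_cvg_on `[0, 1] (nuL R) (@limit_prob R).
Proof.
move=> f cf bf.
have intf mu := bounded_continuous_integrable mu (measurable_itv _) cf bf.
have intE (mu : probability R R) :
    (\int[mu]_(x in `[0%R, 1%R]) (f x)%:E = (\int[mu]_(x in `[0%R, 1%R]) f x)%R%:E)%E.
  by rewrite /Rintegral fineK//; apply: integrable_fin_num (intf mu).
rewrite intE; under eq_fun do rewrite intE.
apply: cvg_EFin; first by near=> n.
rewrite -cvg_shiftS/=.
have [M [Mr MP]] := bf; pose K := `|M| + 1.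
have K0 : 0 < K by rewrite ltr_pwDr.
have fK x : x \in `[0, 1] -> `|f x| <= K.
  by move=> x01; apply: MP => //; rewrite ltr_pwDr// ler_norm.
apply/cvgrPdist_le => e e0.
have e40 : 0 < e / 4 by rewrite divr_gt0.
(* Chosen so that K * 40/(n+1), the distance between the two Riemann sums, is at most e/2; each
   integral then costs a further e/4. *)
have eK0 : 0 < e / (80 * K) by rewrite divr_gt0// mulr_gt0.
near=> n.
have fu : forall x y, x \in `[0, 1] -> y \in `[0, 1] ->
    `|x - y| <= n.+1%:R^-1 -> `|f x - f y| <= e / 4.
  by near: n; exact: itv_uniform_continuity.
have h1 := riemann_sum_approx cf bf fu (limit_prob_set1 (0 : R)).
have h2 := riemann_sum_approx cf bf fu (nuL_set1 R n).
rewrite /= distrC.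
move: h1 h2; set A := (X in `|X - _| <= _); set SA := \sum_(i < _) _.
move=> h1; set B := (X in `|X - _| <= _); set SB := \sum_(i < _) _ => h2.
have h3 : `|SB - SA| <= e / 2.
  rewrite /SB /SA -sumrB (le_trans (ler_norm_sum _ _ _))//.
  apply: (@le_trans _ _ (K * (40 / n.+1%:R))).
    rewrite (le_trans _ (ler_wpM2l (ltW K0) (sum_dist_itv R n)))// mulr_sumr.
    apply: ler_sum => i _; rewrite -mulrBr normrM ler_wpM2r//.
    apply: fK; rewrite in_itv/= divr_ge0//= ler_pdivrMr// mul1r ler_nat.
    exact: ltn_ord.
  have : n.+1%:R^-1 <= e / (80 * K).
    by apply/ltW; near: n; exact: (near_infty_natSinv_lt (PosNum eK0)).
  rewrite ler_pdivlMr ?mulr_gt0//; move: n.+1%:R^-1 => y; lra.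
have -> : B - A = (B - SB) + (SB - SA) - (A - SA) by ring.
apply: (le_trans (ler_normB _ _)); apply: (@le_trans _ _ (3 / 4 * e + e / 4)); last lra.
apply: lerD => //; apply: (le_trans (ler_normD _ _)).
by apply: (@le_trans _ _ (e / 4 + e / 2)); [apply: lerD|lra].
Unshelve. all: by end_near. Qed.

(** * Pointwise limits *)

(** As [nlast_profile] is uniform in the card, [k n] may vary arbitrarily with n, and only the limit
    of the profile remains to be found. *)
Lemma last_card_cvg (R : realType) (k : nat -> nat) (l : R) :
  (forall n, (0 < n)%N -> (0 < k n <= n)%N) ->
  (expR ((k n)%:R / n%:R) - expR (- (n - k n)%:R)) / (expR 1 - 1) @[n --> \oo] --> l ->
  (n%:R%:E * shuffle_prob R (1%g : 'S_n) [set s | last_card s = k n])%E @[n --> \oo] --> l%:E.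
Proof.
move=> kn hl; rewrite -cvg_shiftS/=.
have nE n : (n.+1%:R%:E * shuffle_prob R (1%g : 'S_n.+1) [set s | last_card s = k n.+1])%E
    = (nlast R n (k n.+1).-1)%:E.
  have /andP[k0 _] := kn n.+1 isT.
  rewrite -(prednK k0) shuffle_prob_last -EFinM mulrC divfK//.
under eq_fun do rewrite nE.
apply: cvg_EFin; first by near=> n.
move: hl; rewrite -cvg_shiftS/= => hl.
rewrite -[l]addr0.
have : (profile R n (k n.+1).-1 +
    (nlast R n (k n.+1).-1 - profile R n (k n.+1).-1)) @[n --> \oo] --> l + 0; last first.
  by apply: cvg_trans; apply: near_eq_cvg; near=> n; rewrite addrC subrK.
apply: cvgD.
  apply: cvg_trans hl; apply: near_eq_cvg; near=> n.
  have /andP[k0 _] := kn n.+1 isT.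
  by rewrite /profile prednK// -(prednK k0) subSS.
apply/cvgr0Pnorm_le => e e0.
have e36 : 0 < e / 36 by rewrite divr_gt0.
near=> n.
have /andP[k0 kn1] := kn n.+1 isT.
have kle : ((k n.+1).-1 <= n)%N by rewrite -ltnS prednK.
apply: (le_trans (nlast_profile R kle)).
have : n.+1%:R^-1 <= e / 36.
  by apply/ltW; near: n; exact: (near_infty_natSinv_lt (PosNum e36)).
have : n.+2%:R^-1 <= n.+1%:R^-1 :> R by rewrite lef_pV2 ?posrE// ler_nat.
move: n.+1%:R^-1 n.+2%:R^-1 => y z; lra.
Unshelve. all: by end_near. Qed.

(** Common to (i) and (ii): the divergence of n - b_n n removes the boundary term. *)
Lemma last_card_cvg_scaled (R : realType) (b_ : nat -> R) (b : R) :
  (forall n : nat, (0 < n)%N ->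
     exists2 k : nat, (0 < k <= n)%N & b_ n * n%:R = k%:R) ->
  b_ n @[n --> \oo] --> b -> n%:R - b_ n * n%:R @[n --> \oo] --> +oo ->
  (n%:R%:E * shuffle_prob R (1%g : 'S_n)
     [set s : 'S_n | ((last_card s)%:R = b_ n * n%:R)%R])%E @[n --> \oo] -->
  (expR b / (expR 1 - 1))%:E.
Proof.
move=> bk bb nb.
have /choice[k kP] n : exists k : nat, (0 < n)%N -> (0 < k <= n)%N /\ b_ n * n%:R = k%:R.
  case: n => [|n]; first by exists 0%N.
  by have [k ? ?] := bk n.+1 isT; exists k.
have kn n : (0 < n)%N -> (0 < k n <= n)%N by move=> /kP[].
have H : (expR ((k n)%:R / n%:R) - expR (- (n - k n)%:R)) / (expR 1 - 1) @[n --> \oo]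
    --> expR b / (expR 1 - 1).
  apply: cvgMl.
  have : expR (b_ n) - expR (- (n%:R - b_ n * n%:R)) @[n --> \oo] --> expR b - 0.
    apply: cvgB; first by apply: continuous_cvg => //; exact: continuous_expR.
    exact: (cvg_comp _ _ nb (@cvgr_expR R)).
  rewrite subr0; apply: cvg_trans; apply: near_eq_cvg; near=> n.
  have n0 : (0 < n)%N by near: n; exact: nbhs_infty_gt.
  have [/andP[k0 kn'] kE] := kP n n0.
  by rewrite natrB// -kE mulfK// pnatr_eq0 -lt0n.
apply: cvg_trans (last_card_cvg kn H); apply: near_eq_cvg; near=> n.
have n0 : (0 < n)%N by near: n; exact: nbhs_infty_gt.
have [_ kE] := kP n n0; congr (_ * shuffle_prob _ _ _)%E.
apply/seteqP; split => s /=; rewrite kE; first by move=> ->.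
by move=> /eqP; rewrite eqr_nat => /eqP.
Unshelve. all: by end_near. Qed.

Theorem theorem2 (R : realType) :
  (* (i) *)
  ((forall (b_ : nat -> R) (b : R),
      (forall n : nat, (0 < n)%N ->
         exists2 k : nat, (0 < k <= n)%N & b_ n * n%:R = k%:R) ->
      b_ n @[n --> \oo] --> b -> 0 <= b < 1 ->
      (n%:R%:E * shuffle_prob R (1%g : 'S_n)
         [set s : 'S_n | ((last_card s)%:R = b_ n * n%:R)%R])%E @[n --> \oo] -->
      (expR b / (expR 1 - 1))%:E) /\
   weak_cvg_on `[0, 1] (nuL R) (@limit_prob R)) /\
  (* (ii) *)
  (forall b_ : nat -> R,
     (forall n : nat, (0 < n)%N ->
        exists2 k : nat, (0 < k <= n)%N & b_ n * n%:R = k%:R) ->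
     b_ n @[n --> \oo] --> (1 : R) ->
     n%:R - b_ n * n%:R @[n --> \oo] --> +oo ->
     (n%:R%:E * shuffle_prob R (1%g : 'S_n)
        [set s : 'S_n | ((last_card s)%:R = b_ n * n%:R)%R])%E @[n --> \oo] -->
     (expR 1 / (expR 1 - 1))%:E) /\
  (* (iii) *)
  (forall l : nat,
     (n%:R%:E * shuffle_prob R (1%g : 'S_n)
        [set s : 'S_n | last_card s = (n - l)%N])%E @[n --> \oo] -->
     ((expR 1 - expR (- l%:R)) / (expR 1 - 1))%:E).
Proof.
split; [split; [|exact: weak_cvg_nuL]|split].
- move=> b_ b bk bb /andP[b0 b1]; apply: last_card_cvg_scaled => //.
  have -> : (fun n => n%:R - b_ n * n%:R) = (fun n => (1 - b_ n) * n%:R).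
    by apply/funext => n; rewrite mulrBl mul1r.
  (* Eventually 1 - b_n >= (1 - b)/2, so n - b_n n grows at least linearly. *)
  have c0 : 0 < (1 - b) / 2 by rewrite divr_gt0// subr_gt0.
  apply/cvgryPge => A; near=> n.
  have h1 : b_ n <= (b + 1) / 2.
    near: n; apply: (cvgr_le _ bb); lra.
  have h2 : A / ((1 - b) / 2) <= n%:R by near: n; exact: nbhs_infty_ger.
  rewrite ler_pdivrMr// in h2; apply: (le_trans h2).
  by rewrite mulrC ler_wpM2r//; lra.
- by move=> b_ bk bb nb; exact: last_card_cvg_scaled.
- move=> l.
  (* For n <= l the truncated difference n - l is 0, which is no card; for these finitely many n,
     card n replaces it. *)
  have kn n : (0 < n)%N -> (0 < (if (l < n)%N then n - l else n) <= n)%N.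
    by move=> n0; case: ifP; lia.
  apply: cvg_trans (last_card_cvg kn _).
    apply: near_eq_cvg; near=> n.
    have -> // : (l < n)%N by near: n; exact: nbhs_infty_gt.
  apply: cvgMl.
  (* For card n - l the scaled position tends to 1, while the boundary term keeps the constant value
     e^(-l). *)
  have : expR (1 - l%:R * n%:R^-1) - expR (- l%:R) @[n --> \oo] -->
      (expR (1 - l%:R * 0) - expR (- l%:R) : R).
    apply: cvgB; last exact: cvg_cst.
    apply: continuous_cvg; first exact: continuous_expR.
    apply: cvgB; first exact: cvg_cst.
    by apply: cvgMr; rewrite -cvg_shiftS; exact: cvg_harmonic.
  rewrite mulr0 subr0; apply: cvg_trans; apply: near_eq_cvg; near=> n.
  have ln : (l < n)%N by near: n; exact: nbhs_infty_gt.
  rewrite ln natrB 1?ltnW// mulrBl divff ?pnatr_eq0 -?lt0n ?(leq_ltn_trans _ ln)//.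
  by rewrite subKn// ltnW.
Unshelve. all: by end_near. Qed.
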